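(* Let $G$ be a simple graph on $n$ vertices, and let $D_n$ be the number of derangements of $\{1,\dots,n\}$ (permutations $\sigma$ with $\sigma(i)\ne i$ for all $i$). If $\rho(G)\le D_n^{1/n}$, then $\mathcal{E}_{\mathrm{per}}(G)\le \mathcal{E}_{\mathrm{per}}(K_n)$, where $K_n$ is the complete graph on $n$ vertices.
   Context: $\rho(G)$ is the spectral radius of the adjacency matrix $A(G)$ (largest absolute value of an eigenvalue). The permanental polynomial is $\pi(G,x)=\operatorname{per}(xI-A(G))$, where $\operatorname{per}(M)=\sum_{\sigma\in S_n}\prod_i m_{i,\sigma(i)}$; its roots $\mu_1,\dots,\mu_n\in\mathbb{C}$ are counted with multiplicity, and the permanental energy is $\mathcal{E}_{\mathrm{per}}(G)=\sum_{i=1}^n|\mu_i|$. *)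

(* Defs.v *)
From HB Require Import structures.
From mathcomp Require Import all_boot all_order all_algebra all_fingroup.
From mathcomp Require Import complex.
From mathcomp Require Import boolp classical_sets reals exp.

Set Implicit Arguments.
Unset Strict Implicit.
Unset Printing Implicit Defensive.

Import Order.TTheory GRing.Theory Num.Theory.

Local Open Scope classical_set_scope.
Local Open Scope ring_scope.
Local Open Scope complex_scope.

Import ComplexField.Normc.

Record sgraph (n : nat) := SGraph {
  edge :> rel 'I_n;
  edge_sym : symmetric edge;
  edge_irrefl : irreflexive edge
}.

Lemma complete_edge_sym n : symmetric (fun i j : 'I_n => i != j).
Proof. by move=> i j; rewrite eq_sym. Qed.

Lemma complete_edge_irrefl n : irreflexive (fun i j : 'I_n => i != j).
Proof. by move=> i; rewrite eqxx. Qed.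

Definition complete_graph (n : nat) : sgraph n :=
  SGraph (@complete_edge_sym n) (@complete_edge_irrefl n).

Definition adjmx (R : pzSemiRingType) (n : nat) (G : sgraph n) : 'M[R]_n :=
  \matrix_(i, j) (G i j)%:R.

Definition permanent (R : comPzRingType) (n : nat) (M : 'M[R]_n) : R :=
  \sum_(s : 'S_n) \prod_i M i (s i).

(* [char_poly_mx A] is the matrix 'X%:M - A over {poly R}. *)
Definition perm_poly (R : comNzRingType) (n : nat) (A : 'M[R]_n) : {poly R} :=
  permanent (char_poly_mx A).

(* The roots of p, each repeated according to its multiplicity (for p != 0). *)
Definition closed_roots (C : closedFieldType) (p : {poly C}) : seq C :=
  sval (closed_field_poly_normal p).

(* The set of eigenvalues is finite, so the supremum is a maximum as soon as
   0 < n; for n = 0 it is sup set0 = 0. *)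
Definition spectral_radius (R : realType) (n : nat) (A : 'M[R[i]]_n) : R :=
  sup [set normc z | z in [set z : R[i] | eigenvalue A z]].

Definition perm_energy (R : realType) (n : nat) (G : sgraph n) : R :=
  \sum_(z <- closed_roots (perm_poly (adjmx R[i] G))) normc z.

Definition derangements (n : nat) : {set 'S_n} :=
  [set s : 'S_n | [forall i, s i != i]]%SET.

(* Main.v *)
(* All permanental roots of [G] lie in the disc of radius [rho(G)], so the
   energy of [G] is at most [n * rho(G)]; the roots of [K_n] have product
   [per A(K_n) = D_n], so by AM-GM its energy is at least [n * D_n^(1/n)].

   For the disc, let [|z| = r > rho(G)].  The matrix [r I - A] is positive
   definite with nonpositive off-diagonal entries, so [(r I - A) v = 1] has a
   positive solution [v], and weighting columns by [v] makes [z I - A] strictly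
   diagonally dominant.  Such matrices have nonzero permanent: for [|t| <= 1]
   the column operation [C_j <- C_j + t C_i] after deleting row and column [i]
   preserves dominance, so by induction [q_i + t q_j <> 0], where
   [per M = \sum_j M_ij q_j].  Hence [|q_j| < |q_i|] for [j <> i], and the term
   [M_ii q_i] dominates the expansion. *)
Require Import Defs.
From mathcomp Require Import all_boot all_order all_algebra all_fingroup.
From mathcomp Require Import complex.
From mathcomp Require Import boolp classical_sets reals exp.

Set Implicit Arguments.
Unset Strict Implicit.
Unset Printing Implicit Defensive.

Import Order.TTheory GRing.Theory Num.Theory.
Import ComplexField.Normc.

Local Open Scope ring_scope.
Local Open Scope complex_scope.

(** * Permanents: row expansion, column operations and scaling *)

Lemma perm_neq1_moves (T : finType) (s : {perm T}) :
  s != 1%g -> exists m, s m != m.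
Proof.
move=> s1; apply/existsP; rewrite -negb_forall; apply: contra s1 => /forallP sE.
by apply/eqP/permP => m; rewrite perm1; apply/eqP.
Qed.

Section Permanent.
Context {R : comPzRingType} {n : nat}.
Implicit Type M : 'M[R]_n.

(** The permanent of [M] with row [i] and column [j] deleted, written over ['S_n] so that no matrix
    of smaller size appears. *)
Definition row_minor M (i j : 'I_n) : R :=
  \sum_(s : 'S_n | s i == j) \prod_(k | k != i) M k (s k).

Lemma permanent_row M i : permanent M = \sum_j M i j * row_minor M i j.
Proof.
rewrite /permanent (partition_big (fun s : 'S_n => s i) predT) //=.
apply: eq_bigr => j _; rewrite mulr_sumr; apply: eq_bigr => s /eqP <-.
by rewrite (bigD1 i).
Qed.

Lemma permanent_row_delta M i :
  (forall j, M i j = (j == i)%:R) -> permanent M = row_minor M i i.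
Proof.
move=> Mi; rewrite (permanent_row M i) (bigD1 i) //= Mi eqxx mul1r.
by rewrite big1 ?addr0 // => j /negPf ji; rewrite Mi ji mul0r.
Qed.

Lemma eq_row_minor M (N : 'M[R]_n) i j :
  (forall k l, k != i -> M k l = N k l) -> row_minor M i j = row_minor N i j.
Proof.
by move=> eqMN; apply: eq_bigr => s _; apply: eq_bigr => k /eqMN ->.
Qed.

(* Transposing the columns [i] and [j] identifies the two minors up to the
   column they retain, so a column operation combines them linearly. *)
Lemma row_minor_add_col M i j t : j != i ->
  row_minor (\matrix_(k, l) if l == i then 0 else
                            if l == j then M k j + t * M k i else M k l) i i
  = row_minor M i i + t * row_minor M i j.
Proof.
move=> ji; rewrite /row_minor.
have -> : \sum_(s : 'S_n | s i == j) \prod_(k | k != i) M k (s k) =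
    \sum_(s : 'S_n | s i == i) \prod_(k | k != i) M k ((s * tperm i j)%g k).
  rewrite (reindex_inj (mulIg (tperm i j))) /=.
  by apply: eq_bigl => s; rewrite permM (canF_eq (tpermK i j)) tpermR.
rewrite mulr_sumr -big_split /=; apply: eq_bigr => s /eqP si.
(* Row [m] is the one that [s] sends to column [j]; it is the only row whose factor differs between
   the three products. *)
pose m := (s^-1)%g j.
have sm : s m = j by rewrite /m permKV.
have mi : m != i by apply: contra ji => /eqP mi; rewrite -sm mi si.
rewrite !(bigD1 m mi) /= permM sm tpermR mxE eqxx (negPf ji) mulrDl mulrA.
have neq k : (k != i) && (k != m) -> (s k != i) && (s k != j).
  by rewrite -{2}si -sm !(inj_eq perm_inj).
congr (_ * _ + _ * _); apply: eq_bigr => k /neq /andP[ki kj];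
  rewrite mxE (negPf ki) (negPf kj) //.
by rewrite permM tpermD // eq_sym.
Qed.

Lemma permanent_scale_cols M (v : 'I_n -> R) :
  permanent (\matrix_(i, j) (M i j * v j)) = permanent M * \prod_j v j.
Proof.
rewrite /permanent mulr_suml; apply: eq_bigr => s _.
rewrite [\prod_j v j](reindex_inj (@perm_inj _ s)) -big_split /=.
by apply: eq_bigr => i _; rewrite mxE.
Qed.

Lemma permanentN M : permanent (- M) = (-1) ^+ n * permanent M.
Proof.
rewrite /permanent mulr_sumr; apply: eq_bigr => s _.
rewrite -[X in _ ^+ X]card_ord -prodr_const -big_split /=.
by apply: eq_bigr => i _; rewrite mxE mulN1r.
Qed.

End Permanent.

(** * Nonvanishing of the permanent under strict diagonal dominance *)

Section DominantPermanent.
Context {F : numFieldType} {n : nat}.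
Implicit Type M : 'M[F]_n.

Definition diag_dominant M :=
  forall i, \sum_(j | j != i) `|M i j| < `|M i i|.

(** Induction on the number of rows that differ from those of the identity. Row [i] is deleted in
    place by making it an identity row, so the dimension stays fixed. *)
Lemma permanent_diag_dominant M : diag_dominant M -> permanent M != 0.
Proof.
pose nontriv (N : 'M[F]_n) := [pred i | [exists j, N i j != (j == i)%:R :> F]].
have [k] := ubnP #|nontriv M|.
elim: k M => // k IHk M; rewrite ltnS => cardM domM.
have [i /existsP [l Mil] | trivM] := pickP (nontriv M); last first.
  rewrite (_ : permanent M = 1) ?oner_neq0 //.
  have eqM i j : M i j = (j == i)%:R.
    apply/eqP; move/negbT: (trivM i).
    by rewrite negb_exists => /forallP/(_ j)/negPn.
  rewrite /permanent (bigD1 1%g) //= big1 ?big1 ?addr0 // => [s s1|j _].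
    have [m sm] := perm_neq1_moves s1.
    by rewrite (bigD1 m) //= eqM (negPf sm) mul0r.
  by rewrite eqM perm1 eqxx.
(* Resetting row [i] to the identity row lowers the induction measure. *)
have step (N : 'M[F]_n) : (forall m, N i m = (m == i)%:R) ->
    (forall m, m != i -> \sum_(j | j != m) `|N m j| < `|N m m|) ->
    (forall m, m != i -> m \notin nontriv M -> m \notin nontriv N) ->
    row_minor N i i != 0.
  move=> Ni domN subN; rewrite -permanent_row_delta //; apply: IHk.
    apply: leq_trans cardM; apply: proper_card; apply/properP; split.
      apply/fintype.subsetP => m; apply: contraLR => mM.
      have [->|mi] := eqVneq m i; last exact: subN.
      by rewrite inE negb_exists; apply/forallP => j; rewrite Ni eqxx.
    exists i; first by rewrite inE; apply/existsP; exists l.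
    by rewrite inE negb_exists; apply/forallP => j; rewrite Ni eqxx.
  move=> m; have [->|] := eqVneq m i; last exact: domN.
  rewrite Ni eqxx normr1 big1 ?ltr01 // => j /negPf ji.
  by rewrite Ni ji normr0.
have trivE (N : 'M[F]_n) m :
    (m \notin nontriv N) = [forall j, N m j == (j == m)%:R].
  by rewrite inE negb_exists; apply: eq_forallb => j; rewrite negbK.
pose reset (N : 'M[F]_n) :=
  \matrix_(m, j) (if m == i then (j == i)%:R else N m j).
have resetE N j : row_minor (reset N) i j = row_minor N i j.
  by apply: eq_row_minor => m p /negPf mi; rewrite mxE mi.
have minor0 : row_minor M i i != 0.
  rewrite -resetE; apply: step => [m|m mi|m /negPf mi].
  - by rewrite mxE eqxx.
  - under eq_bigr do rewrite mxE (negPf mi).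
    by rewrite mxE (negPf mi).
  - rewrite !trivE => /forallP trivMm; apply/forallP => j.
    by rewrite mxE mi.
have minor_lt j : j != i -> `|row_minor M i j| < `|row_minor M i i|.
  move=> ji; rewrite real_ltNge ?normr_real //; apply/negP => le_minor.
  have minorj0 : row_minor M i j != 0.
    by rewrite -normr_gt0; apply: lt_le_trans le_minor; rewrite normr_gt0.
  (* The coefficient that would cancel the combined minor; the assumed inequality gives it modulus
     at most 1. *)
  pose t := - (row_minor M i i / row_minor M i j).
  have t1 : `|t| <= 1.
    by rewrite normrN normf_div ler_pdivrMr ?normr_gt0 // mul1r.
  suff : row_minor M i i + t * row_minor M i j != 0.
    by rewrite mulNr divfK // subrr eqxx.
  rewrite -row_minor_add_col // -resetE; set N := reset _.
  have NE m p : m != i -> N m p = if p == i then 0 else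
      if p == j then M m j + t * M m i else M m p.
    by move=> /negPf mi; rewrite !mxE mi.
  apply: step => [m|m mi|m mi].
  - by rewrite mxE eqxx.
  (* Clearing column [i] lowers the off-diagonal sum of row [m] by [|M m i|], while entry [j]
     changes by at most that much, whether it lies on the diagonal ([m = j]) or off it. *)
  - under eq_bigr do rewrite NE //.
    rewrite (NE m m mi) (negPf mi) (bigD1 i) 1?eq_sym //= eqxx normr0 add0r.
    have := domM m; rewrite (bigD1 i) 1?eq_sym //=.
    have tM : `|t * M m i| <= `|M m i|.
      by rewrite normrM ler_piMl.
    have [mj|mj] := eqVneq m j.
      rewrite -ltrBrDl => /lt_le_trans ltM.
      apply: le_lt_trans (ltM _ (le_trans _ (lerB_normD _ _))); last first.
        by rewrite -mj lerD2l lerN2.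
      apply: ler_sum => p /andP[pm pi].
      by rewrite (negPf pi) -mj (negPf pm).
    rewrite (bigD1 j) /=; last by rewrite eq_sym mj.
    rewrite [X in _ -> X < _](bigD1 j) /=; last by rewrite eq_sym mj.
    apply: le_lt_trans; rewrite addrA lerD //.
      rewrite (negPf ji) eqxx; apply: le_trans (ler_normD _ _) _.
      by rewrite [leRHS]addrC lerD.
    apply: ler_sum => p /andP[/andP[pm pi] pj].
    by rewrite (negPf pi) (negPf pj).
  (* An identity row [m != i] has a zero in column [i], so the column operation leaves it
     unchanged. *)
  - rewrite !trivE => /forallP trivMm; apply/forallP => p; rewrite NE //.
    have -> : M m i = 0 by rewrite (eqP (trivMm i)) eq_sym (negPf mi).
    rewrite mulr0 addr0; case: (eqVneq p i) => [->|_].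
      by rewrite [i == m]eq_sym (negPf mi).
    by case: (eqVneq p j) => [->|_]; exact: trivMm.
rewrite (permanent_row M i) (bigD1 i) //= -normr_gt0.
apply: lt_le_trans (lerB_normD _ _); rewrite subr_gt0 normrM.
apply: le_lt_trans (ler_norm_sum _ _ _) _.
apply: (@le_lt_trans _ _ (\sum_(j | j != i) `|M i j| * `|row_minor M i i|)).
  by apply: ler_sum => j /minor_lt/ltW ltj; rewrite normrM ler_wpM2l.
by rewrite -mulr_suml ltr_pM2r // normr_gt0.
Qed.

End DominantPermanent.

Lemma permanent_weighted_diag_dominant (F : numFieldType) (n : nat)
    (M : 'M[F]_n) (v : 'I_n -> F) : (forall i, 0 < v i) ->
  (forall i, \sum_(j | j != i) `|M i j| * v j < `|M i i| * v i) ->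
  permanent M != 0.
Proof.
move=> v0 domM.
suff : permanent (\matrix_(i, j) (M i j * v j)) != 0.
  by rewrite permanent_scale_cols mulf_eq0 negb_or => /andP[].
have normv i j : `|M i j * v j| = `|M i j| * v j.
  by rewrite normrM (gtr0_norm (v0 j)).
apply: permanent_diag_dominant => i; rewrite mxE normv.
by under eq_bigr do rewrite mxE normv.
Qed.

(** * Quadratic forms of normal matrices *)

Section Spectral.
Local Open Scope sesquilinear_scope.
Context {C : numClosedFieldType} {n : nat}.
Implicit Type A : 'M[C]_n.

Lemma spectral_diag_eigenvalue A k :
  A \is normalmx -> eigenvalue A (spectral_diag A 0 k).
Proof.
move=> /orthomx_spectralP eqA; pose P := spectralmx A.
have unitP : P \in unitmx := spectral_unit A.
apply/eigenvalueP; exists (row k P).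
  rewrite -row_mul [in LHS]eqA !mulmxA mulmxV // mul1mx.
  by apply/rowP => j; rewrite mul_diag_mx !mxE.
apply/eqP => Pk0; have := mulmxV unitP.
move/(congr1 (row k)); rewrite row_mul Pk0 mul0mx => /rowP/(_ k).
by rewrite !mxE eqxx => /eqP; rewrite eq_sym oner_eq0.
Qed.

(** In unitary eigencoordinates [w] the form is the sum of [d_k |w_k|^2], where each [d_k] is an
    eigenvalue. *)
Lemma normal_form_le A r (u : 'rV_n) : A \is normalmx ->
  (forall a, eigenvalue A a -> `|a| <= r) ->
  `|(u *m A *m u^t*) 0 0| <= r * (u *m u^t*) 0 0.
Proof.
move=> normA ler; pose P := spectralmx A; pose d := spectral_diag A.
have unitP : P \is unitarymx := spectral_unitarymx A.
have eqA : A = P^t* *m diag_mx d *m P.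
  by rewrite -invmx_unitary //; apply/orthomx_spectralP.
set w := u *m P^t*.
have wt : w^t* = P *m u^t* by rewrite /w trmx_mul map_mxM trmxCK.
have -> : u *m A *m u^t* = w *m diag_mx d *m w^t*.
  by rewrite wt [in LHS]eqA !mulmxA.
have -> : u *m u^t* = w *m w^t*.
  by rewrite wt mulmxA mulmxKtV.
move: w {wt} => w; rewrite !mxE mulr_sumr.
apply: le_trans (ler_norm_sum _ _ _) _.
apply: ler_sum => k _; rewrite mul_mx_diag !mxE.
rewrite [w 0 k * _]mulrC -mulrA normrM -normCK normrX normr_id.
by rewrite ler_wpM2r ?exprn_ge0 // ler // spectral_diag_eigenvalue.
Qed.

End Spectral.

(** * Positive solutions for positive definite matrices with nonpositive off-diagonal entries *)

Section MMatrix.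
Context {R : realFieldType} {n : nat}.

(* If [w] is the negative part of the solution [v] of [v B = 1], then
   [(v + w) B w^T <= 0], hence [w B w^T <= - \sum_i w_i <= 0] and [w = 0]. *)
Lemma posdef_Zmatrix_solution (B : 'M[R]_n) :
  (forall i j, i != j -> B i j <= 0) ->
  (forall u : 'rV_n, u != 0 -> 0 < (u *m B *m u^T) 0 0) ->
  exists2 v : 'rV_n, (forall i, 0 < v 0 i) & v *m B = const_mx 1.
Proof.
move=> offB posB.
have unitB : B \in unitmx.
  rewrite unitmxE unitfE; apply/negP => /det0P [u u0 uB].
  by have := posB u u0; rewrite uB mul0mx mxE ltxx.
have [v vB] : exists v : 'rV_n, v *m B = const_mx 1.
  by exists (const_mx 1 *m invmx B); rewrite mulmxKV.
exists v => // i.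
have [w wE] : exists w : 'rV_n, forall j, w 0 j = Num.max 0 (- v 0 j).
  by exists (\row_j Num.max 0 (- v 0 j)) => j; rewrite mxE.
have w_ge0 j : 0 <= w 0 j by rewrite wE le_max lexx.
have vw_ge0 j : 0 <= v 0 j + w 0 j.
  by rewrite wE -lerBlDl sub0r le_max lexx orbT.
(* [v + w] is the positive part of [v], so its support is disjoint from that of [w], and only
   off-diagonal entries of [B] enter [(v + w) B w^T]. *)
have vw0 j : (v 0 j + w 0 j) * w 0 j = 0.
  rewrite wE; case: (lerP (- v 0 j) 0) => _; rewrite ?mulr0 //.
  by rewrite subrr mul0r.
have w0 : w = 0.
  apply/eqP; apply: contraT => /posB; apply: contraTT => _; rewrite -leNgt.
  have -> : w *m B *m w^T = (v + w) *m B *m w^T - v *m B *m w^T.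
    by rewrite !mulmxDl addrAC subrr add0r.
  rewrite mxE [X in _ + X]mxE subr_le0 vB.
  apply: (@le_trans _ _ 0); last first.
    by rewrite mxE sumr_ge0 // => k _; rewrite !mxE mul1r.
  rewrite mxE sumr_le0 // => k _; rewrite !mxE mulr_suml sumr_le0 // => j _.
  rewrite !mxE mulrAC; have [->|jk] := eqVneq j k; first by rewrite vw0 mul0r.
  by rewrite mulr_ge0_le0 ?mulr_ge0 ?offB.
have v_ge0 j : 0 <= v 0 j by have := vw_ge0 j; rewrite w0 mxE addr0.
(* If [v_i = 0], the diagonal term of [(v B)_i] vanishes and the others are nonpositive,
   contradicting [(v B)_i = 1]. *)
rewrite lt_neqAle v_ge0 andbT eq_sym; apply/eqP => vi0.
have /rowP/(_ i) := vB; rewrite !mxE => /eqP; apply/negP.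
rewrite lt_eqF //; apply: le_lt_trans ltr01.
rewrite sumr_le0 // => j _; have [->|ji] := eqVneq j i.
  by rewrite vi0 mul0r.
by rewrite mulr_ge0_le0 // offB.
Qed.

End MMatrix.

(** * The permanental polynomial and its roots *)

Section PermPoly.
Context {n : nat}.

Lemma horner_perm_poly (R : comNzRingType) (A : 'M[R]_n) x :
  (perm_poly A).[x] = permanent (x%:M - A).
Proof.
rewrite /perm_poly /permanent horner_sum; apply: eq_bigr => s _.
rewrite horner_prod; apply: eq_bigr => i _.
by rewrite !mxE hornerD hornerN hornerMn hornerX hornerC.
Qed.

Lemma perm_poly_lead (R : idomainType) (A : 'M[R]_n) :
  size (perm_poly A) = n.+1 /\ perm_poly A \is monic.
Proof.
pose d := \prod_i ('X - (A i i)%:P).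
pose q := \sum_(s : 'S_n | s != 1%g) \prod_i char_poly_mx A i (s i).
have eqdq : perm_poly A = d + q.
  rewrite /perm_poly /permanent (bigD1 1%g) //=; congr (_ + _).
  by apply: eq_bigr => i _; rewrite perm1 !mxE eqxx.
have size_d : size d = n.+1.
  by rewrite size_prod_XsubC /index_enum -enumT size_enum_ord.
have size_q : (size q < size d)%N.
  rewrite size_d ltnS; apply: (leq_trans (size_sum _ _ _)).
  apply/bigmax_leqP => s s1.
  have [m sm] := perm_neq1_moves s1.
  (* The product has size at most one plus the sum of the sizes, minus [n]. Each factor has size at
     most 2, and the one at the moved point [m] at most 1. *)
  apply: leq_trans (size_poly_prod_leq _ _) _.
  rewrite card_ord leq_subLR addnn -muln2.
  rewrite -[in leqRHS](card_ord n) -sum_nat_const.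
  rewrite (bigD1 m) //= [in leqRHS](bigD1 m) //= -addSn leq_add //.
    rewrite !mxE eq_sym (negPf sm) mulr0n sub0r size_polyN ltnS.
    exact: size_polyC_leq1.
  apply: leq_sum => i _; rewrite !mxE; case: eqP => _.
    by rewrite size_XsubC.
  by rewrite sub0r size_polyN (leq_trans (size_polyC_leq1 _)).
rewrite eqdq size_polyDl //; split => //.
by rewrite monicE lead_coefDl // -monicE monic_prod_XsubC.
Qed.

Lemma closed_roots_monic (C : closedFieldType) (p : {poly C}) : p \is monic ->
  p = \prod_(z <- closed_roots p) ('X - z%:P).
Proof.
rewrite /closed_roots; case: closed_field_poly_normal => r /= eqp /monicP lead1.
by rewrite [LHS]eqp lead1 scale1r.
Qed.

Lemma size_roots_perm_poly (C : closedFieldType) (A : 'M[C]_n) :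
  size (closed_roots (perm_poly A)) = n.
Proof.
have [sizeP monP] := perm_poly_lead A; apply: succn_inj.
by rewrite -sizeP [in RHS](closed_roots_monic monP) size_prod_XsubC.
Qed.

Lemma root_perm_poly (C : closedFieldType) (A : 'M[C]_n) z :
  z \in closed_roots (perm_poly A) -> permanent (z%:M - A) = 0.
Proof.
have [_ /closed_roots_monic eqp] := perm_poly_lead A.
by rewrite -root_prod_XsubC -eqp -horner_perm_poly => /rootP.
Qed.

(** Evaluation at 0 yields a factor [(-1)^n] on both sides, which cancels. *)
Lemma prod_roots_perm_poly (C : closedFieldType) (A : 'M[C]_n) :
  \prod_(z <- closed_roots (perm_poly A)) z = permanent A.
Proof.
have [_ /closed_roots_monic /(congr1 (horner^~ 0))] := perm_poly_lead A.
rewrite horner_perm_poly raddf0 sub0r permanentN horner_prod.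
under eq_bigr do rewrite hornerXsubC sub0r -mulN1r.
rewrite big_split /= big_const_seq count_predT size_roots_perm_poly.
by rewrite iter_mulr_1 => /mulfI ->; rewrite // signr_eq0.
Qed.

End PermPoly.

(** * The derangement count as a permanent, and AM-GM for real powers *)

Lemma permanent_complete_graph (R : comNzRingType) n :
  permanent (adjmx R (complete_graph n)) = #|derangements n|%:R.
Proof.
rewrite /permanent -sum1_card natr_sum [RHS]big_mkcond /=.
apply: eq_bigr => s _.
rewrite inE; case: forallP => [ds|].
  by rewrite big1 // => i _; rewrite mxE /= eq_sym ds.
move/forallP; rewrite negb_forall => /existsP [i si].
by rewrite (bigD1 i) //= mxE /= eq_sym (negPf si) mul0r.
Qed.

Lemma powR_prod_le_sum (R : realType) (s : seq R) : (0 < size s)%N ->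
  {in s, forall x, 0 <= x} ->
  (size s)%:R * (\prod_(x <- s) x) `^ (size s)%:R^-1 <= \sum_(x <- s) x.
Proof.
move=> s0 s_ge0; set n := size s.
have n0 : 0 < n%:R :> R by rewrite ltr0n.
have sum_ge0 : 0 <= \sum_(x <- s) x by rewrite big_seq sumr_ge0.
have AGM : \prod_(x <- s) x <= ((\sum_(x <- s) x) / n%:R) ^+ n.
  rewrite (big_nth 0) [in leRHS](big_nth 0) !big_mkord.
  have [i _|+ _] := leif_AGM (A := 'I_n) (E := fun i => s`_i).
    exact/s_ge0/mem_nth.
  by rewrite card_ord.
rewrite mulrC -ler_pdivlMr //.
apply: (@le_trans _ _ ((((\sum_(x <- s) x) / n%:R) ^+ n) `^ n%:R^-1)).
  apply: ge0_ler_powR => //; rewrite ?nnegrE ?invr_ge0 ?exprn_ge0 ?divr_ge0 //.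
  by rewrite big_seq prodr_ge0.
rewrite -powR_mulrn ?divr_ge0 // -powRrM mulfV ?lt0r_neq0 //.
by rewrite powRr1 ?divr_ge0.
Qed.

(** * Permanental roots lie in the disc of the spectral radius *)

Section SpectralRadius.
Context {R : realType} {n : nat}.

Lemma le_spectral_radius (A : 'M[R[i]]_n) a :
  eigenvalue A a -> normc a <= spectral_radius A.
Proof.
move=> eiga; apply: ub_le_sup; last by exists a.
pose p := char_poly A.
(* The supremum needs a bounded set: eigenvalues are roots of [char_poly A], so the sum of the
   moduli of these roots bounds each of them. *)
exists (\sum_(z <- closed_roots p) normc z) => _ [z + <-].
rewrite /= eigenvalue_root_char (closed_roots_monic (char_poly_monic A)).
rewrite root_prod_XsubC => rz; rewrite (perm_big _ (perm_to_rem rz)) /=.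
rewrite big_cons lerDl sumr_ge0 // => w _.
by rewrite -lecR; exact: (normr_ge0 w).
Qed.

Lemma adjmx_complex (G : sgraph n) :
  adjmx R[i] G = map_mx (real_complex R) (adjmx R G).
Proof. by apply/matrixP => i j; rewrite !mxE rmorph_nat. Qed.

(** Over [R[i]] the adjacency matrix is real symmetric, hence normal, and [normal_form_le] applies
    to the real vector [u]. *)
Lemma adjmx_form_le (G : sgraph n) (u : 'rV[R]_n) :
  (u *m adjmx R G *m u^T) 0 0
    <= spectral_radius (adjmx R[i] G) * (u *m u^T) 0 0.
Proof.
set rho := spectral_radius _.
have normA : adjmx R[i] G \is normalmx.
  apply: symmetric_normalmx.
    apply/is_hermitianmxP; rewrite scale1r map_mx_id //.
    by apply/matrixP => i j; rewrite !mxE edge_sym.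
  by apply/mxOverP => i j; rewrite mxE realn.
have eig_le a : eigenvalue (adjmx R[i] G) a -> `|a| <= rho%:C.
  by move=> /le_spectral_radius; rewrite -lecR.
have := normal_form_le (map_mx (real_complex R) u) normA eig_le.
have -> : map_mx Num.conj (map_mx (real_complex R) u)^T
    = map_mx (real_complex R) u^T.
  by apply/matrixP => i j; rewrite !mxE; exact: conjc_real.
rewrite adjmx_complex -!map_mxM ![_ 0 0]mxE -rmorphM => le_form.
rewrite -lecR; apply: le_trans le_form.
by rewrite real_ler_norm //; apply/complex_realP; eexists.
Qed.

Lemma normc_root_perm_poly_adjmx (G : sgraph n) z :
  z \in closed_roots (perm_poly (adjmx R[i] G)) ->
  normc z <= spectral_radius (adjmx R[i] G).
Proof.
move=> /root_perm_poly perz; rewrite leNgt; apply/negP => ltz.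
have [i j /negPf ij|u u0|v v_gt0 vB] :=
    posdef_Zmatrix_solution (B := (normc z)%:M - adjmx R G).
- by rewrite !mxE ij mulr0n sub0r oppr_le0 ler0n.
- rewrite mulmxBr mulmxBl mxE [X in _ + X]mxE subr_gt0.
  apply: le_lt_trans (adjmx_form_le G u) _.
  rewrite mul_mx_scalar -scalemxAl [ltRHS]mxE ltr_pM2r //.
  have /rV0Pn [i ui] := u0.
  rewrite mxE (bigD1 i) //= mxE -expr2 ltr_wpDr ?exprn_even_gt0 //.
  by rewrite sumr_ge0 // => j _; rewrite mxE -expr2 sqr_ge0.
have /eqP : permanent (z%:M - adjmx R[i] G) != 0; last by rewrite perz.
apply: (@permanent_weighted_diag_dominant _ _ _ (fun i => (v 0 i)%:C)).
  by move=> i; rewrite ltcR.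
move=> i.
(* By symmetry and the zero diagonal, the weighted off-diagonal sum is [(v A)_i], and [v B = 1]
   reads [|z| v_i = 1 + (v A)_i]. *)
rewrite (_ : \sum_(j | _) _ = ((v *m adjmx R G) 0 i)%:C).
  have -> : (z%:M - adjmx R[i] G) i i = z.
    by rewrite !mxE eqxx edge_irrefl subr0.
  rewrite -[`|z|]/((normc z)%:C) -rmorphM ltcR.
  have /rowP/(_ i) := vB; rewrite mulmxBr mul_mx_scalar.
  move: (v *m adjmx R G) => vA; rewrite !mxE => /eqP.
  by rewrite subr_eq => /eqP ->; rewrite ltrDr.
rewrite mxE rmorph_sum [RHS](bigD1 i) //= mxE edge_irrefl mulr0 add0r.
apply: eq_bigr => j ji; rewrite !mxE eq_sym (negPf ji) sub0r normrN.
by rewrite rmorphM rmorph_nat normr_nat mulrC edge_sym.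
Qed.

End SpectralRadius.

(** * Comparison of the two energies *)

Theorem theorem4p10 (R : realType) (n : nat) (G : sgraph n) :
  spectral_radius (adjmx R[i] G) <= #|derangements n|%:R `^ n%:R^-1 ->
  perm_energy R G <= perm_energy R (complete_graph n).
Proof.
move=> le_rho.
(* The case [n = 0] is separate because AM-GM is applied to a nonempty list of roots. *)
have [n0|n_gt0] := posnP n.
  have no_roots (A : 'M[R[i]]_n) : closed_roots (perm_poly A) = [::].
    by apply/size0nil; rewrite size_roots_perm_poly.
  by rewrite /perm_energy !no_roots !big_nil.
pose rG := closed_roots (perm_poly (adjmx R[i] G)).
pose rK := closed_roots (perm_poly (adjmx R[i] (complete_graph n))).
apply: (@le_trans _ _ (n%:R * spectral_radius (adjmx R[i] G))).
  have -> : n%:R * spectral_radius (adjmx R[i] G)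
      = \sum_(z <- rG) spectral_radius (adjmx R[i] G).
    rewrite big_const_seq count_predT size_roots_perm_poly iter_addr_0.
    by rewrite mulr_natl.
  rewrite /perm_energy -/rG big_seq [leRHS]big_seq ler_sum // => z.
  exact: normc_root_perm_poly_adjmx.
apply: le_trans (ler_wpM2l (ler0n _ _) le_rho) _.
(* The product of the moduli is the modulus of [per A(K_n)], a natural number. *)
have -> : #|derangements n|%:R = \prod_(x <- [seq normc z | z <- rK]) x.
  rewrite big_map; apply: complexI; rewrite rmorph_nat rmorph_prod.
  rewrite -(permanent_complete_graph R[i]) -normr_prod.
  rewrite (prod_roots_perm_poly (adjmx R[i] (complete_graph n))).
  by rewrite permanent_complete_graph normr_nat.
have roots_ge0 : {in [seq normc z | z <- rK], forall x, 0 <= x}.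
  by move=> _ /mapP [z _ ->]; rewrite -lecR; exact: (normr_ge0 z).
have := powR_prod_le_sum _ roots_ge0.
by rewrite size_map size_roots_perm_poly [leRHS]big_map; apply.
Qed.
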